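(* The map $\phi:\bigcup_{n\ge0}\mathcal{LF}_n\to\bigcup_{n\ge0}\mathcal{IS}_{n+1}(102)$ is a bijection with $\mathrm{height}(Q)=\mathrm{rank}(\phi(Q))$ for every labeled $F$-path $Q$.
   Context: **Inversion sequences.** An inversion sequence of length $n$ is an integer sequence $e=(e_1,\dots,e_n)$ with $0\le e_j\le j-1$ for all $j$. It avoids $102$ if there are no $i<j<k$ with $e_j<e_i<e_k$; $\mathcal{IS}_n(102)$ is the set of those of length $n$ avoiding $102$. $\max(e)$ is the largest entry, and $\mathrm{fdes}(e)$ is the position $p$ of the first descent: $e_1\le\cdots\le e_p>e_{p+1}$, with the convention $e_{n+1}=-1$. For $e\in\mathcal{IS}_n(102)$ one has $e_p=\max(e)$ for $p=\mathrm{fdes}(e)$, and $\mathrm{rank}(e):=\mathrm{fdes}(e)-\max(e)-1\ge 0$. **Labeled $F$-paths.** Let $F=\{(a,1):a\ge0\}\cup\{(a,b):a\ge1,b\le0\}$ ($a,b$ integers). An $F$-path is a lattice path $(x_0,y_0)=(0,0),(x_1,y_1),\dots,(x_\ell,y_\ell)$ in $\mathbb Z^2$ not going below the line $y=x$ and all of whose steps $(x_j-x_{j-1},y_j-y_{j-1})$ lie in $F$. A labeled $F$-path is an $F$-path in which each step $(a,1)$ has label $(a;1)$, and each step $(a,b)$ with $b\le0$ has a label $(a;b_1,\dots,b_k)$ with $k\ge1$, nonpositive integers $b_i$, $b_1+\cdots+b_k=b$. A step with label $(a;b_1,\dots,b_k)$ has semilength $k$ (a step labeled $(a;1)$ has semilength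 $1$); the semilength of the path is the sum of semilengths of its steps. $\mathcal{LF}_n$ is the set of labeled $F$-paths of semilength $n$; $\mathrm{height}(Q)=y_\ell-x_\ell$. **The map $\phi$** (it sends $\mathcal{LF}_n$ into $\mathcal{IS}_{n+1}(102)$), defined recursively. The path with no steps is sent to $(0)$. For $Q$ with $\ell\ge1$ steps, let $\hat Q$ be $Q$ with its last step removed, $\hat e=\phi(\hat Q)$, $\hat p=\mathrm{fdes}(\hat e)$, and, if the last step is $(a,b)$, $m=\max(\hat e)+a$. (1) If the last label is $(a;1)$ with $a\ge 0$, $\phi(Q)$ is obtained from $\hat e$ by inserting one entry $m$ immediately after $\hat e_{\hat p}$. (2) If the last label is $(a;b_1,\dots,b_k)$ with $a\ge1$ and all $b_i\le0$, $\phi(Q)$ is obtained from $\hat e$ by inserting $k$ entries equal to $m$, immediately after the entries $\hat e_{j_1},\dots,\hat e_{j_k}$, where $j_1=\hat p+b_1+\cdots+b_k-1$ and $j_i=\hat p+b_i+\cdots+b_k$ for $2\le i\le k$ (coinciding $j_i$'s mean multiple insertions at the same place). *)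

(* Defs.v *)
From HB Require Import structures.
From mathcomp Require Import all_boot all_order all_algebra.
From mathcomp Require Import boolp classical_sets functions.

Set Implicit Arguments.
Unset Strict Implicit.
Unset Printing Implicit Defensive.

Import Order.TTheory GRing.Theory Num.Theory.

Local Open Scope ring_scope.
Local Open Scope classical_set_scope.

(* A sequence e = (e_1, ..., e_n) is a [seq int] whose item i (from 0) is
   e_(i+1), so that 0 <= e_j <= j - 1 becomes 0 <= e`_i <= i. *)
Definition inversion_seq (e : seq int) : Prop :=
  forall i : nat, (i < size e)%N -> 0 <= e`_i <= i%:Z.

Definition avoids102 (e : seq int) : Prop :=
  forall i j k : nat, (i < j)%N -> (j < k)%N -> (k < size e)%N ->
    ~ (e`_j < e`_i /\ e`_i < e`_k).

Definition IS102 (n : nat) : set (seq int) :=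
  [set e | [/\ size e = n, inversion_seq e & avoids102 e]].

(* The base value 0 is harmless: entries of inversion sequences are >= 0. *)
Definition maxe (e : seq int) : int := \big[Num.max/0]_(x <- e) x.

(* 1-based position of the first descent; the default value -1 of [nth] is the
   convention e_(n+1) = -1. *)
Definition fdes (e : seq int) : nat :=
  (find (fun i : nat => nth (-1) e i.+1 < nth (-1) e i) (iota 0 (size e))).+1.

Definition rank (e : seq int) : int := (fdes e)%:Z - maxe e - 1.

Definition in_F (s : int * int) : bool :=
  (0 <= s.1) && (s.2 == 1) || (1 <= s.1) && (s.2 <= 0).

(* A lattice path starting at the origin is given by its list of steps. *)
Definition vertices (s : seq (int * int)) : seq (int * int) :=
  0 :: scanl (fun P v => P + v) 0 s.

Definition F_path (s : seq (int * int)) : bool :=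
  all in_F s && all (fun P : int * int => P.1 <= P.2) (vertices s).

(* The pair (a, [:: b_1; ...; b_k]) stands for the label (a; b_1, ..., b_k),
   and (a, [:: 1]) for (a; 1). A label determines the step carrying it, so a
   labeled path is given by its list of labels. *)
Definition label : Type := (int * seq int)%type.

Definition step_of (l : label) : int * int := (l.1, \sum_(b <- l.2) b).

Definition label_ok (l : label) : bool :=
  (l.2 == [:: 1]) || (0 < size l.2)%N && all (fun b : int => b <= 0) l.2.

Definition labeled_F_path (Q : seq label) : bool :=
  F_path (map step_of Q) && all label_ok Q.

Definition semilength (Q : seq label) : nat := (\sum_(l <- Q) size l.2)%N.

Definition LF (n : nat) : set (seq label) :=
  [set Q | labeled_F_path Q /\ semilength Q = n].

Definition height (Q : seq label) : int :=
  let P := last 0 (vertices (map step_of Q)) in P.2 - P.1.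

(* Simultaneously inserts, for each j in js (with multiplicity), an entry m
   immediately after e_j, where j is a 1-based position in e. *)
Definition insert_after (m : int) (js : seq int) (e : seq int) : seq int :=
  flatten [seq e`_i :: nseq (count_mem i.+1%:Z js) m | i <- iota 0 (size e)].

(* j_1 = p + b_1 + ... + b_k - 1, and j_i = p + b_i + ... + b_k for i >= 2;
   note that [drop i bs] starts with b_(i+1). *)
Definition ins_positions (p : int) (bs : seq int) : seq int :=
  (p + \sum_(b <- bs) b - 1) ::
  [seq p + \sum_(b <- drop i bs) b | i <- iota 1 (size bs).-1].

Definition phi_step (e : seq int) (l : label) : seq int :=
  let p := (fdes e)%:Z in
  let m := maxe e + l.1 in
  if l.2 == [:: 1] then insert_after m [:: p] e
  else insert_after m (ins_positions p l.2) e.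

(* [foldl] recurses on the last step: phi (rcons Q l) = phi_step (phi Q) l. *)
Definition phi (Q : seq label) : seq int := foldl phi_step [:: 0] Q.

(* Main.v *)
Require Import Defs.
From mathcomp Require Import all_boot all_order all_algebra.
From mathcomp Require Import boolp classical_sets functions.
From mathcomp Require Import zify.

(* A 102-avoiding inversion sequence with first descent at its entry [M] is
   [s ++ M :: t] with [rcons s M] weakly increasing and all of [t] at most [M];
   its rank is [size s - M]. Each step of [phi] turns it into a sequence
   [s' ++ m :: t'] of the same kind, whose rank changes by b - a.
   Steps (a;1) give [head t' < last s'], since [m] is put right after [M]; the
   other steps give [last s' <= head t'], since these two entries were adjacent
   in [rcons s M]. In the first case the step is undone by deleting [m] at the
   first descent. In the second case [m] is a new strict maximum, so the step is
   undone by deleting all copies of [m]; by avoidance of 102, the other entries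
   before the last copy of [m] increase weakly, so all insertions took place at
   or before the first descent of the old sequence, and the numbers b_i are read
   off the gaps between consecutive copies of [m]. *)

Set Implicit Arguments.
Unset Strict Implicit.
Unset Printing Implicit Defensive.

Import Order.TTheory GRing.Theory Num.Theory.

Local Open Scope ring_scope.
Local Open Scope classical_set_scope.

(** * Subsequences, avoidance of 102 and inversion sequences *)

Lemma cons_subseqP (x : int) (u e : seq int) :
  reflect (exists2 i, (i < size e)%N & e`_i = x /\ subseq u (drop i.+1 e))
          (subseq (x :: u) e).
Proof.
apply: (iffP idP) => [|[i ie [<- sub]]].
  elim: e => [//|y e IH] /=; case: eqP => [->|_] sub.
    by exists 0%N => //=; rewrite drop0.
  by have [i ie H] := IH sub; exists i.+1.
rewrite -{2}(cat_take_drop i e) (drop_nth 0 ie).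
apply: subseq_trans (suffix_subseq _ _); by rewrite /= eqxx.
Qed.

Lemma subseq_catP (T : eqType) (u s t : seq T) :
  subseq u (s ++ t) ->
  exists u1 u2, [/\ u = u1 ++ u2, subseq u1 s & subseq u2 t].
Proof.
case/subseqP => m; rewrite size_cat => sm ->.
have st : size (take (size s) m) = size s by rewrite size_take sm; case: ltnP; lia.
exists (mask (take (size s) m) s), (mask (drop (size s) m) t).
by rewrite -mask_cat // cat_take_drop !mask_subseq.
Qed.

Lemma subseq2_sorted (s : seq int) :
  reflect (forall x y, subseq [:: x; y] s -> x <= y) (sorted <=%R s).
Proof.
rewrite le_sorted_pairwise; apply: (iffP idP).
  elim: s => [//|z s IH] /= /andP[/allP za /IH{}IH] x y.
  case: eqP => [->|_]; last exact: IH.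
  by rewrite sub1seq => /za.
elim: s => [//|z s IH] H /=; apply/andP; split.
  by apply/allP => y ys; apply: H; rewrite /= eqxx sub1seq.
by apply: IH => x y sub; apply: H; apply: subseq_trans sub (subseq_cons _ _).
Qed.

(** Without indices, avoidance passes at once to subsequences, and patterns can be followed through
    insertion and deletion of entries. *)
Lemma avoids102P (e : seq int) :
  avoids102 e <-> forall x y z, subseq [:: x; y; z] e -> ~ (y < x /\ x < z).
Proof.
split=> H.
  move=> x y z /cons_subseqP[i ie [<-]] /cons_subseqP[j].
  rewrite size_drop nth_drop drop_drop => je [<-] /cons_subseqP[k].
  rewrite size_drop nth_drop => ke [<- _].
  by apply: H; lia.
move=> i j k ij jk ke; apply: H.
apply/cons_subseqP; exists i; first by lia.
split=> //; apply/cons_subseqP; exists (j - i.+1)%N.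
  by rewrite size_drop; lia.
rewrite nth_drop drop_drop; split; first by congr nth; lia.
rewrite sub1seq; have -> : e`_k = (drop j.+1 e)`_(k - j.+1) by rewrite nth_drop subnKC.
rewrite (_ : (j - i.+1).+1 + i.+1 = j.+1)%N; last by lia.
by apply: mem_nth; rewrite size_drop ltn_sub2r //; apply: leq_ltn_trans jk ke.
Qed.

(** The 0-based positions occupied by [t] are all at least [size s], so one uniform bound
    suffices. *)
Lemma inversion_seq_cat (s t : seq int) :
  inversion_seq s -> all (fun x => 0 <= x <= (size s)%:Z) t ->
  inversion_seq (s ++ t).
Proof.
move=> Is /(@all_nthP int _ _ 0) at_ i; rewrite size_cat (@nth_cat int) => ie.
case: ltnP => [/Is //|si].
have /at_ : (i - size s < size t)%N by lia.
by lia.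
Qed.

Lemma inversion_seq_catl (s t : seq int) :
  inversion_seq (s ++ t) -> inversion_seq s.
Proof. by move=> I i si; have := I i; rewrite size_cat (@nth_cat int) si; apply;
  lia. Qed.

(** * Decomposition at the first descent *)

(* [s ++ M :: t] is a 102-avoiding inversion sequence with first descent at [M]. *)
Record first_descent (s : seq int) (M : int) (t : seq int) : Prop := FirstDescent {
  fd_sorted : sorted <=%R (rcons s M);
  fd_inv : inversion_seq s;
  fd_bound : 0 <= M <= (size s)%:Z;
  fd_head : head (-1) t < M;
  fd_tail : all (fun x => 0 <= x <= M) t;
  fd_avoid : avoids102 (s ++ M :: t) }.

Lemma fd_IS102 s M t :
  first_descent s M t -> IS102 (size (s ++ M :: t)) (s ++ M :: t).
Proof.
case=> ss Is Mb _ ta av; split=> //; apply: inversion_seq_cat => //=.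
by rewrite Mb; apply: sub_all ta => x; lia.
Qed.

Lemma first_descent_split (x : int) (e : seq int) :
  all (fun y => 0 <= y) (x :: e) ->
  exists s M t, [/\ x :: e = s ++ M :: t, sorted <=%R (rcons s M)
                  & head (-1) t < M].
Proof.
elim: e x => [|y e IH] x /= /andP[x0 ye].
  (* A nonnegative last entry is a descent, because of the default -1. *)
  by exists [::], x, [::]; split=> //=; lia.
case: (lerP x y) => xy; last by exists [::], x, (y :: e).
have [s [M [t [Ee so he]]]] := IH y ye.
exists (x :: s), M, t; split=> //=; first by rewrite Ee.
by case: s Ee so => [|z s] /= [<- _] so; rewrite xy.
Qed.

Lemma IS102_fd n e :
  IS102 n.+1 e -> exists s M t, e = s ++ M :: t /\ first_descent s M t.
Proof.
case=> se Ie av; case: e se Ie av => [//|x e] se Ie av.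
have e0 : all (fun y => 0 <= y) (x :: e).
  by apply/(@all_nthP int _ _ 0) => i /Ie /andP[].
have [s [M [t [Ee so he]]]] := first_descent_split e0.
exists s, M, t; split=> //; rewrite {}Ee in se Ie av e0 *.
have Mb : 0 <= M <= (size s)%:Z.
  by have := Ie (size s); rewrite size_cat (@nth_cat int) ltnn subnn /=; apply; lia.
split=> //; first exact: inversion_seq_catl Ie.
move: e0; rewrite all_cat => /andP[_ /andP[_ /allP t0]].
apply/allP => z zt; rewrite t0 //=.
case: t he zt av {se Ie t0} => [//|y t] /= yM.
rewrite inE => /predU1P[->|zt] av; first exact: ltW.
(* As [y < M], a later [z > M] would make [M], [y], [z] a 102. *)
rewrite leNgt; apply/negP => Mz.
have /avoids102P H := av; apply: (H M y z) => //.
apply: subseq_trans (suffix_subseq _ _).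
by rewrite /= !eqxx sub1seq.
Qed.

Lemma fdes_cat s M t :
  sorted <=%R (rcons s M) -> head (-1) t < M -> fdes (s ++ M :: t) = (size s).+1.
Proof.
rewrite /fdes => so he; congr _.+1.
elim: s so => [|x s IH] so /=.
  by rewrite (_ : nth (-1) t 0 < M) // nth0.
have [xl {}so] : x <= nth (-1) (s ++ M :: t) 0 /\ sorted <=%R (rcons s M).
  by case: s so {IH} => [|y s] /= /andP[xy].
rewrite ltNge xl /=; congr _.+1.
by rewrite -[in RHS](IH so) (iotaDl 1 0) find_map.
Qed.

Lemma fd_fdes s M t : first_descent s M t -> fdes (s ++ M :: t) = (size s).+1.
Proof. by case=> *; apply: fdes_cat. Qed.

Lemma fd_le s M t x : first_descent s M t -> x \in s ++ M :: t -> x <= M.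
Proof.
case=> so _ _ _ /allP ta _; rewrite mem_cat inE => /or3P[xs|/eqP-> //|/ta/andP[]//].
move: so; rewrite le_sorted_pairwise -cats1 pairwise_cat => /andP[/allP/(_ x xs)].
by rewrite /= andbT.
Qed.

Lemma fd_maxe s M t : first_descent s M t -> maxe (s ++ M :: t) = M.
Proof.
move=> fd; apply/eqP; rewrite eq_le; apply/andP; split.
  rewrite /maxe big_seq; elim/big_ind: _ => [|x y xM yM|x].
  - by case/andP: (fd_bound fd).
  - by rewrite ge_max xM.
  - exact: fd_le.
by apply: (le_bigmax_seq _ _ _ (fun x => x)) => //; rewrite mem_cat mem_head orbT.
Qed.

Lemma fd_rank s M t :
  first_descent s M t -> rank (s ++ M :: t) = (size s)%:Z - M.
Proof. by move=> fd; rewrite /rank fd_fdes // fd_maxe //; lia. Qed.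

Lemma fd_inj s1 M1 t1 s2 M2 t2 :
  first_descent s1 M1 t1 -> first_descent s2 M2 t2 ->
  s1 ++ M1 :: t1 = s2 ++ M2 :: t2 -> [/\ s1 = s2, M1 = M2 & t1 = t2].
Proof.
move=> fd1 fd2 E.
have /eqP : fdes (s1 ++ M1 :: t1) = fdes (s2 ++ M2 :: t2) by rewrite E.
rewrite !fd_fdes // eqSS => /eqP sz.
by move/eqP: E; rewrite eqseq_cat // => /andP[/eqP-> /eqP[-> ->]].
Qed.

(** * Inserting copies of one letter, encoded by gaps *)

Section Weave.
Variables (T : eqType) (m : T).
Implicit Types (ds : seq nat) (e w : seq T).

(** Each item of [ds] counts the entries of [e] passed before the next copy of [m]; a later item 0
    puts two copies side by side. With gaps instead of positions, undoing an insertion is a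
    structural induction. *)
Fixpoint weave ds e : seq T :=
  if ds is d :: ds' then take d e ++ m :: weave ds' (drop d e) else e.

Let drop_cat_le d e w : (d <= size e)%N -> drop d (e ++ w) = drop d e ++ w.
Proof.
by rewrite drop_cat; case: ltngtP => // -> _; rewrite subnn drop0 drop_size.
Qed.

Lemma size_weave ds e : size (weave ds e) = (size ds + size e)%N.
Proof.
elim: ds e => [//|d ds IH] e /=.
by rewrite size_cat /= IH -[in RHS](cat_take_drop d e) size_cat; lia.
Qed.

Lemma weave_cat ds e w :
  (sumn ds <= size e)%N -> weave ds (e ++ w) = weave ds e ++ w.
Proof.
elim: ds e => [//|d ds IH] e /= de.
have {}de : (d <= size e)%N && (sumn ds <= size (drop d e))%N.
  by rewrite size_drop; lia.
case/andP: de => de dse.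
by by rewrite takel_cat // drop_cat_le // -catA /= IH.
Qed.

Lemma filter_weave ds e :
  m \notin e -> [seq x <- weave ds e | x != m] = e.
Proof.
move=> me; have {}me : all (fun x => x != m) e.
  by apply/allP => x xe; apply: contraNneq me => <-.
elim: ds e me => [|d ds IH] e me /=; first exact/all_filterP.
have := me; rewrite -{1}(cat_take_drop d e) all_cat => /andP[met med].
rewrite filter_cat /= eqxx /= IH // -[RHS](cat_take_drop d e).
by rewrite (all_filterP met).
Qed.

Lemma weave_inj ds1 ds2 e :
  m \notin e -> (sumn ds1 <= size e)%N -> (sumn ds2 <= size e)%N ->
  weave ds1 e = weave ds2 e -> ds1 = ds2.
Proof.
elim: ds1 ds2 e => [|d1 ds1 IH] [|d2 ds2] e me //=.
- by move=> _ _ E; move: me; rewrite E mem_cat mem_head orbT.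
- by move=> _ _ E; move: me; rewrite -E mem_cat mem_head orbT.
move=> s1 s2 E.
have idx d w : (d <= size e)%N -> index m (take d e ++ m :: w) = d.
  move=> de; rewrite index_cat ifN ?size_take /=; last first.
    by apply: contra me; apply: mem_take.
  by rewrite eqxx addn0; case: ltngtP de.
have d12 : d1 = d2.
  have := congr1 (index m) E; rewrite !idx //; lia.
rewrite -{d2}d12 in s2 E *; congr cons.
move/eqP: E; rewrite eqseq_cat // eqxx /= eqseq_cons eqxx /= => /eqP.
apply: IH; rewrite ?size_drop; [|lia|lia].
by apply: contra me; apply: mem_drop.
Qed.

Lemma weave_filter w :
  exists2 ds, w = weave ds [seq x <- w | x != m]
    & (sumn ds <= size [seq x <- w | x != m])%N.
Proof.
elim: w => [|x w [ds Ew sds]] /=; first by exists [::].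
case: eqP => [->|_] /=.
  by exists (0%N :: ds); rewrite //= take0 drop0 -Ew.
by case: ds Ew sds => [|d ds] /= Ew sds; [exists [::] | exists (d.+1 :: ds)];
  rewrite //= -Ew.
Qed.

(** The last copy of [m] stands after exactly the first [sumn ds] entries of [e], so it can serve as
    the 2 of a 102 that starts with two of them. *)
Lemma subseq_weave ds e :
  ds != [::] -> subseq (rcons (take (sumn ds) e) m) (weave ds e).
Proof.
elim: ds e => [//|d ds IH] e _ /=.
rewrite takeD rcons_cat cat_subseq //.
case: ds IH => [|d' ds] IH; first by rewrite /= take0 /= eqxx sub0seq.
by apply: subseq_trans (IH _ _) (subseq_cons _ _).
Qed.

End Weave.

(** * From insertion positions to gaps *)

Lemma scanl_addn a c ds : scanl addn (a + c)%N ds = map (addn a) (scanl addn c ds).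
Proof. by elim: ds c => [//|d ds IH] c /=; rewrite -addnA IH. Qed.

Lemma insert_after_cons (m : int) js (x : int) e :
  insert_after m js (x :: e) =
  x :: nseq (count_mem 1 js) m ++ insert_after m [seq j - 1 | j <- js] e.
Proof.
rewrite /insert_after /= (iotaDl 1 0) -map_comp; congr (_ :: _ ++ flatten _).
apply: eq_map => i /=; congr (_ :: nseq _ _).
rewrite count_map; apply: eq_count => j /=; lia.
Qed.

(** The insertion positions are the partial sums of the gaps. Position 0 is split off because
    [insert_after] inserts only after existing entries. *)
Lemma weave_insert (m : int) ds (e : seq int) :
  (sumn ds <= size e)%N ->
  let js := [seq n%:Z | n <- scanl addn 0%N ds] in
  weave m ds e = nseq (count_mem 0 js) m ++ insert_after m js e.
Proof.
elim: ds e => [|d ds IH] e.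
  by move=> _ /=; elim: e => [//|x e IHe]; rewrite insert_after_cons; congr cons.
elim: d e => [|d IHd] [|x e] //= se.
- by rewrite IH.
- by rewrite IH.
have := IHd e se; rewrite insert_after_cons /= !add0n => ->.
rewrite [X in _ = nseq X _ ++ _](_ : _ = 0%N) /=; last first.
  rewrite -(addn0 d.+1) scanl_addn -map_comp /= count_map; apply/eqP;
    rewrite -leqn0 leqNgt -has_count.
  by apply/hasPn => n _ /=; lia.
rewrite -(add1n d) scanl_addn -!map_comp !count_map;
  congr (_ :: nseq _ _ ++ insert_after _ _ _).
by congr cons; [lia | apply: eq_map => n /=; lia].
Qed.

(** Nonpositive labels b_i are written as -g_i with natural numbers g_i, so that sums of them count
    entries. *)
Definition oppz_seq (gs : seq nat) : seq int := [seq - g%:Z | g <- gs].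

Lemma sum_oppz_seq gs : \sum_(b <- oppz_seq gs) b = - (sumn gs)%:Z.
Proof. by elim: gs => [|g gs IH]; rewrite ?big_nil // big_cons IH /=; lia. Qed.

(* The numbers j_1, j_2 - j_1, ..., j_k - j_(k-1) for b_i = - g_i; the number
   p - j_k, which [belast] drops, is the last entry of g_1 + 1, g_2, ..., g_k. *)
Definition gaps (p g : nat) (gs : seq nat) : seq nat :=
  belast (p - sumn (g.+1 :: gs))%N (g.+1 :: gs).

(** Subtracting a suffix sum of the g_i from their total leaves a prefix sum. *)
Lemma suffix_sums_scanl (q g : nat) (gs : seq nat) :
  [seq (q + g + sumn gs)%N%:Z + \sum_(b <- drop i (oppz_seq (g :: gs))) b
    | i <- iota 1 (size gs)] = [seq n%:Z | n <- scanl addn q (belast g gs)].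
Proof.
elim: gs q g => [//|h gs IH] q g.
rewrite [iota _ _]/= !map_cons (iotaDl 1 1) -map_comp; congr cons.
  by rewrite -[drop 1 _]/(oppz_seq (h :: gs)) sum_oppz_seq /=; lia.
by rewrite -(IH (q + g)%N h) -(addnA (q + g));
  apply: eq_map => i; rewrite /= -addnA.
Qed.

Lemma ins_positionsE (p g : nat) (gs : seq nat) :
  (sumn (g.+1 :: gs) <= p)%N ->
  ins_positions p%:Z (oppz_seq (g :: gs)) =
  [seq n%:Z | n <- scanl addn 0%N (gaps p g gs)].
Proof.
move=> sp; rewrite /ins_positions sum_oppz_seq /= add0n; congr cons.
  by move: sp => /=; lia.
(* [q] is j_1. Only j_1 carries the extra -1, so the other positions are counted from [q.+1]; this 1
   is absorbed into the first gap [g.+1]. *)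
set q := (p - _)%N; have Ep : p = (q.+1 + g + sumn gs)%N by rewrite /q;
  move: sp => /=; lia.
rewrite size_map [in LHS]Ep suffix_sums_scanl; congr map.
by case: (gs) => [//|h gs'] /=; rewrite addSnnS.
Qed.

Lemma size_gaps p g gs : size (gaps p g gs) = (size gs).+1.
Proof. by rewrite size_belast. Qed.

Lemma sumn_gaps p g gs :
  (sumn (g.+1 :: gs) <= p)%N -> (sumn (gaps p g gs) <= p)%N.
Proof.
move=> sp; have := congr1 sumn (lastI (p - sumn (g.+1 :: gs))%N (g.+1 :: gs)).
by rewrite sumn_rcons -/(gaps p g gs) [sumn (_ :: _ :: _)]/=; move: sp => /=; lia.
Qed.

(** The first gap determines the sum of the g_i and the others determine all g_i but the last, which
    then follows from the sum. *)
Lemma gaps_inj p g1 gs1 g2 gs2 :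
  (sumn (g1.+1 :: gs1) <= p)%N -> (sumn (g2.+1 :: gs2) <= p)%N ->
  gaps p g1 gs1 = gaps p g2 gs2 -> g1 :: gs1 = g2 :: gs2.
Proof.
move=> sp1 sp2; rewrite /gaps /= => -[E1 E2].
have E3 : sumn (g1.+1 :: gs1) = sumn (g2.+1 :: gs2) by move: sp1 sp2 E1 => /=; lia.
suff [-> ->] : g1.+1 :: gs1 = g2.+1 :: gs2 by [].
move: E3; rewrite !lastI !sumn_rcons E2 => /eqP.
by rewrite eqn_add2l => /eqP ->.
Qed.

(** The list [g.+1 :: gs] is [ds] completed by the entry that makes its sum [p - d]. The head
    condition says that this list starts with a positive number; for empty [ds] that number is
    [p - d] itself, whence the default. *)
Lemma gaps_surj p d ds :
  (d + sumn ds <= p)%N -> head (p - d)%N ds != 0%N ->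
  exists g gs, (sumn (g.+1 :: gs) = p - d)%N /\ gaps p g gs = d :: ds.
Proof.
move=> dp hd.
have [g [gs Eg]] : exists g gs, rcons ds (p - (d + sumn ds))%N = g.+1 :: gs.
  case: ds dp hd => [|[|h] ds] //= dp hd.
    by exists (p - d).-1, [::]; congr cons; lia.
  by exists h, (rcons ds (p - (d + (h.+1 + sumn ds)))%N).
have Es : (sumn (g.+1 :: gs) = p - d)%N by rewrite -Eg sumn_rcons; lia.
exists g, gs; split=> //.
rewrite /gaps Es -Eg belast_rcons; congr cons; lia.
Qed.

(** * One step of the map on decomposed sequences *)

Lemma phi_step_weave e a g gs :
  (sumn (g.+1 :: gs) < fdes e <= size e)%N ->
  phi_step e (a, oppz_seq (g :: gs)) = weave (maxe e + a) (gaps (fdes e) g gs) e.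
Proof.
case/andP=> sf fs; rewrite /phi_step [_.1]/= [_.2]/= ifF;
  last by apply/negP => /eqP[]; lia.
rewrite -/(oppz_seq (g :: gs)) ins_positionsE; last by lia.
rewrite (weave_insert _ (leq_trans (sumn_gaps (ltnW sf)) fs)).
(* All positions are at least j_1, which is positive since the sum is less than [fdes e]. *)
rewrite (_ : count_mem 0 _ = 0%N) //; apply/eqP.
rewrite -leqn0 leqNgt -has_count; apply/hasPn => _ /mapP[n ns ->] /=.
have : (0 < fdes e - sumn (g.+1 :: gs))%N by rewrite subn_gt0.
move: ns; rewrite /gaps /= add0n -[in scanl _ _](addn0 (_ - _)%N) scanl_addn inE.
by case/predU1P => [->|/mapP[n' _ ->]]; lia.
Qed.

Lemma phi_step_up e a :
  (fdes e <= size e)%N ->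
  phi_step e (a, [:: 1]) = weave (maxe e + a) [:: fdes e] e.
Proof.
move=> fs; rewrite /phi_step eqxx weave_insert /= ?addn0 // add0n.
Qed.

Lemma sorted_rcons2 (s : seq int) x y :
  sorted <=%R (rcons s x) -> x <= y -> sorted <=%R (rcons (rcons s x) y).
Proof.
by case: s => [|z s] /=; [move=> _ -> | rewrite !rcons_path last_rcons => -> ->].
Qed.

Lemma phi_step_up_fd s M t a :
  first_descent s M t -> 0 <= a -> M + a <= (size s).+1%:Z ->
  phi_step (s ++ M :: t) (a, [:: 1]) = rcons s M ++ (M + a) :: t /\
  first_descent (rcons s M) (M + a) t.
Proof.
move=> fd a0 aM; split.
  rewrite phi_step_up fd_fdes ?fd_maxe //; last by rewrite size_cat /=; lia.
  rewrite -cat_rcons -[weave _ _ _]/(take _ _ ++ _ :: drop _ _).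
  by rewrite take_size_cat ?drop_size_cat ?size_rcons.
have [so Is Mb ht ta av] := fd.
split=> //.
- by apply: sorted_rcons2 => //; lia.
- by rewrite -cats1; apply: inversion_seq_cat => //=; rewrite Mb.
- by rewrite size_rcons; lia.
- by lia.
- by apply: sub_all ta => x; lia.
(* As a largest entry, [M + a] could only be the 2 of a 102, but the entries before it increase
   weakly. A 102 without it would already occur in the old sequence. *)
apply/avoids102P => x y z sub [yx xz].
have le v : v \in rcons s M ++ (M + a) :: t -> v <= M + a.
  rewrite mem_cat inE orbCA => /predU1P[-> //|vin].
  by apply: (@le_trans _ _ M); [apply: (fd_le fd);
    rewrite -cat_rcons mem_cat | lia].
have zM : z <= M + a by apply: le; apply: (mem_subseq sub); rewrite !inE eqxx !orbT.
have [u1 [u2 [Eu sub1 sub2]]] := subseq_catP sub.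
have /avoids102P av' := av.
case: u2 Eu sub2 => [|v u2] Eu sub2.
  apply: (av' x y z) => //; rewrite -cat_rcons Eu cats0.
  by apply: subseq_trans sub1 (prefix_subseq _ _).
have : v \in [:: x; y; z] by rewrite Eu mem_cat mem_head orbT.
move: sub2 => /=; case: eqP => [Ev _|_ sub2]; last first.
  move=> _; apply: (av' x y z) => //.
  by rewrite -cat_rcons Eu cat_subseq.
rewrite {}Ev in Eu * => _.
have {}sub1 : subseq [:: x; y] (rcons s M).
  apply: subseq_trans sub1.
  case: u1 Eu => [|x' [|y' u1]] /=; [by case; lia|by case=> _; lia|].
  by case=> <- <- _; rewrite !eqxx sub0seq.
by have := subseq2_sorted _ so _ _ sub1; lia.
Qed.

Lemma phi_step_down_fd s M t a g gs :
  first_descent s M t -> 1 <= a -> M + a + (sumn (g :: gs))%:Z <= (size s)%:Z ->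
  exists s' t', [/\ phi_step (s ++ M :: t) (a, oppz_seq (g :: gs)) =
                      s' ++ (M + a) :: t',
                    first_descent s' (M + a) t',
                    size s' = (size s - sumn (g :: gs))%N
                  & last 0 s' <= head (-1) t'].
Proof.
move=> fd a1 aM; have [so Is Mb ht ta av] := fd.
set m := M + a; set S := rcons s M; set e := s ++ M :: t.
have Ee : e = S ++ t by rewrite /e /S cat_rcons.
have sS : size S = (size s).+1 by rewrite size_rcons.
have sG : (sumn (g.+1 :: gs) <= size s)%N by move: aM => /=; lia.
(* This is j_1: the first copy of [m] goes between the adjacent entries number [n] and [n.+1] of
   [S]. *)
pose n := (size S - sumn (g.+1 :: gs))%N.
have nS : (n < size S)%N by rewrite /n sS /=; lia.
have me : m \notin e by apply/negP => /(fd_le fd); rewrite /m; lia.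
have Ephi : phi_step e (a, oppz_seq (g :: gs)) = weave m (gaps (size S) g gs) e.
  rewrite phi_step_weave fd_fdes ?fd_maxe ?sS // ltnS sG.
  by rewrite /e size_cat /=; lia.
have Ed : drop n e = S`_n :: drop n.+1 S ++ t.
  by rewrite Ee drop_cat nS (drop_nth 0 nS).
have Et : take n e = take n S by rewrite Ee takel_cat // ltnW.
pose r := drop n.+1 S ++ t.
pose t' := weave m (belast g.+1 gs) (S`_n :: r).
have Ew : weave m (gaps (size S) g gs) e = take n S ++ m :: t'.
  by rewrite /gaps /= -/n Ed Et.
(* The next gap, if any, is [g.+1], hence nonzero: this is the effect of the -1 in j_1. *)
have ht' : head (-1) t' = S`_n by rewrite /t'; case: (gs).
exists (take n S), t'; rewrite Ephi Ew.
have st : size (take n S) = n by rewrite size_take nS.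
have soy : sorted <=%R (rcons (take n S) S`_n).
  by rewrite -take_nth //; apply: take_sorted.
have Sn : S`_n \in e by rewrite Ee mem_cat mem_nth.
have inv_e : inversion_seq e.
  by have [] := fd_IS102 fd.
have e0 x : x \in e -> 0 <= x.
  by case/(nthP 0) => i ie <-; have /andP[] := inv_e i ie.
have fil : [seq x <- take n S ++ m :: t' | x != m] = e by rewrite -Ew filter_weave.
have in_e x : x \in take n S ++ m :: t' -> x != m -> x \in e.
  by rewrite -fil mem_filter => -> ->.
have lem x : x \in take n S ++ m :: t' -> x <= m.
  move=> xin; have [-> //|xm] := eqVneq x m.
  by have := fd_le fd (in_e _ xin xm); rewrite /m; lia.
split=> //; first split=> //.
- move: soy; rewrite !le_sorted_pairwise -!cats1 !pairwise_cat => /and3P[_ -> _].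
  rewrite /= andbT; apply/allrelP => x y xn; rewrite inE => /eqP->.
  by apply: lem; rewrite mem_cat xn.
- by apply: (@inversion_seq_catl _ (drop n e)); rewrite -Et cat_take_drop.
- by rewrite st /n sS /m /=; move: aM => /=; lia.
- by rewrite ht'; have := fd_le fd Sn; rewrite /m; lia.
- apply/allP => x xt;
  have xin : x \in take n S ++ m :: t' by rewrite mem_cat inE xt !orbT.
  rewrite lem // andbT; have [->|/(in_e _ xin)/e0 //] := eqVneq x m.
  by rewrite /m; lia.
- apply/avoids102P => x y z sub [yx xz].
  have zm : z <= m by apply: lem; apply: (mem_subseq sub); rewrite !inE eqxx !orbT.
  have /avoids102P av' := av.
  (* Both [x] and [y] lie below [z <= m], so if [z] is not [m] either, the 102 survives the deletion
     of [m]. If [z = m], then [x] and [y] come from [S], since no copy of [m] lies in [t]; but [S]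
     increases weakly. *)
  have [Ez|zNm] := eqVneq z m; last first.
    by apply: (av' x y z) => //; rewrite -/e -fil subseq_filter sub /= zNm; lia.
  move: sub; rewrite -Ew Ee weave_cat; last by apply: sumn_gaps; rewrite sS; lia.
  move/subseq_catP => [u1 [u2 [Eu sub1 sub2]]].
  have mt : m \notin t by apply: contra me => mt; rewrite Ee mem_cat mt orbT.
  case/lastP: u2 Eu sub2 => [|u2 v] Eu sub2; last first.
    move: Eu; rewrite -rcons_cat -[[:: x; y; z]]/(rcons [:: x; y] z).
    move/eqP; rewrite eqseq_rcons => /andP[_ /eqP Ev].
    move: mt; rewrite -Ez Ev (mem_subseq sub2) //.
    by rewrite mem_rcons mem_head.
  have mS : m \notin S by apply: contra me => mS; rewrite Ee mem_cat mS.
  have : subseq [:: x; y] S.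
    rewrite -(filter_weave (gaps (size S) g gs) mS) subseq_filter /=.
    apply/andP; split; first by lia.
    apply: subseq_trans sub1; rewrite cats0 in Eu; rewrite -Eu.
    by rewrite /= !eqxx.
  by move/(subseq2_sorted _ so); lia.
- by rewrite st /n sS /=; lia.
rewrite ht'; move: soy; case: (take n S) => [|x s0] /=; first by rewrite e0.
by rewrite rcons_path => /andP[].
Qed.

(** * Admissible labels, and their effect on the decomposition *)

(** These are the conditions for appending [l] to a labeled path, with the rank of [e] in place of
    the height, so that they refer to sequences only. *)
Definition valid_step (e : seq int) (l : label) : bool :=
  [&& in_F (step_of l), label_ok l & 0 <= rank e + (step_of l).2 - (step_of l).1].

Lemma nonpos_oppz_seq (bs : seq int) :
  all (fun b => b <= 0) bs -> exists gs, bs = oppz_seq gs.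
Proof.
elim: bs => [|b bs IH] /=; first by exists [::].
by case/andP=> b0 /IH[gs ->]; exists (`|b|%N :: gs); congr cons; lia.
Qed.

(** Each upper bound on [M + a] says that the new maximum is at most the number of entries that will
    precede the new first descent, that is, the new rank is nonnegative. *)
Variant valid_step_spec (s : seq int) (M : int) : label -> Prop :=
| ValidUp a of 0 <= a & M + a <= (size s).+1%:Z : valid_step_spec s M (a, [:: 1])
| ValidDown a g gs of 1 <= a & M + a + (sumn (g :: gs))%:Z <= (size s)%:Z :
    valid_step_spec s M (a, oppz_seq (g :: gs)).

Lemma valid_stepP s M t l :
  first_descent s M t -> valid_step (s ++ M :: t) l <-> valid_step_spec s M l.
Proof.
move=> fd; rewrite /valid_step fd_rank //; split.
  case: l => a bs /and3P[]; rewrite /in_F /label_ok /step_of /=.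
  have [-> | _ /=] := eqVneq bs [:: 1].
    by rewrite big_seq1 => aF _ h; constructor; lia.
  move=> aF /andP[bs0 /nonpos_oppz_seq[gs Ebs]]; move: aF bs0; rewrite {}Ebs.
  case: gs => [//|g gs]; rewrite sum_oppz_seq => aF _ h.
  by constructor; move: aF h => /=; lia.
case=> [a a0 aM|a g gs a1 aM]; apply/and3P; rewrite /in_F /label_ok /step_of /=.
  by rewrite big_seq1; split=> //; lia.
have := sum_oppz_seq (g :: gs); move: aM => /= aM ->; split; [lia| |lia].
apply/orP; right; apply/andP; split; first by lia.
by apply/allP => _ /mapP[h _ ->]; lia.
Qed.

(** The last clause allows the kind of the label to be read off the image. *)
Lemma phi_step_fd s M t l :
  first_descent s M t -> valid_step (s ++ M :: t) l ->
  exists s' t', [/\ phi_step (s ++ M :: t) l = s' ++ (M + l.1) :: t',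
    first_descent s' (M + l.1) t',
    (size s')%:Z = (size s)%:Z + (step_of l).2
  & (l.2 == [:: 1]) = (head (-1) t' < last 0 s')].
Proof.
move=> fd /(valid_stepP _ fd)[a a0 aM|a g gs a1 aM].
  have [E fd'] := phi_step_up_fd fd a0 aM.
  exists (rcons s M), t; rewrite E /step_of /= big_seq1 size_rcons last_rcons.
  by split=> //; [lia | rewrite (fd_head fd)].
have [s' [t' [E fd' ss' lh]]] := phi_step_down_fd fd a1 aM.
exists s', t'; rewrite E /step_of sum_oppz_seq ltNge lh; split=> //=.
  by rewrite ss'; move: aM (fd_bound fd) => /=; lia.
by apply/negP => /eqP[]; lia.
Qed.

Lemma size_phi_step s M t l :
  first_descent s M t -> valid_step (s ++ M :: t) l ->
  size (phi_step (s ++ M :: t) l) = (size (s ++ M :: t) + size l.2)%N.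
Proof.
move=> fd /(valid_stepP _ fd)[a a0 aM|a g gs a1 aM].
  have [-> _] := phi_step_up_fd fd a0 aM.
  by rewrite -cat_rcons !size_cat /=; lia.
rewrite phi_step_weave ?fd_fdes ?size_weave ?size_gaps ?size_map //=; first by lia.
by rewrite size_cat; move: aM => /=; have := fd_bound fd; lia.
Qed.

(** * Injectivity of one step *)

Lemma phi_step_inj s1 M1 t1 l1 s2 M2 t2 l2 :
  let e1 := s1 ++ M1 :: t1 in let e2 := s2 ++ M2 :: t2 in
  first_descent s1 M1 t1 -> first_descent s2 M2 t2 ->
  valid_step e1 l1 -> valid_step e2 l2 ->
  phi_step e1 l1 = phi_step e2 l2 -> e1 = e2 /\ l1 = l2.
Proof.
move=> e1 e2 fd1 fd2 v1 v2.
have [s1' [t1' [E1 fd1' _ up1]]] := phi_step_fd fd1 v1.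
have [s2' [t2' [E2 fd2' _ up2]]] := phi_step_fd fd2 v2.
rewrite E1 E2 => E; have [Es Em Et] := fd_inj fd1' fd2' E.
have {up1 up2 Es Et} up : (l1.2 == [:: 1]) = (l2.2 == [:: 1]).
  by rewrite up1 up2 Es Et.
move: Em up E {fd1' fd2'}; rewrite -E1 -E2 {s1' t1' s2' t2' E1 E2}.
have neg1 g gs : (oppz_seq (g :: gs) == [:: 1]) = false.
  by apply/negP => /eqP[]; lia.
move/(valid_stepP _ fd1) : v1 => [a1 a10 aM1|a1 g1 gs1 a11 aM1];
  move/(valid_stepP _ fd2) : v2 => [a2 a20 aM2|a2 g2 gs2 a21 aM2];
  rewrite /= ?neg1 //= => Em _.
  have [-> fd1'] := phi_step_up_fd fd1 a10 aM1.
  have [-> fd2'] := phi_step_up_fd fd2 a20 aM2.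
  case/(fd_inj fd1' fd2') => /eqP;
    rewrite eqseq_rcons => /andP[/eqP Es /eqP EM] _ Et.
  by rewrite /e1 /e2 Es EM Et; split=> //; congr pair; lia.
have nin s M t a : first_descent s M t -> 1 <= a -> M + a \notin s ++ M :: t.
  by move=> fd a_gt0; apply/negP => /(fd_le fd); lia.
have bnd s M t a g gs : first_descent s M t -> 1 <= a ->
    M + a + (sumn (g :: gs))%:Z <= (size s)%:Z ->
    (sumn (g.+1 :: gs) < (size s).+1 <= size (s ++ M :: t))%N.
  by move=> fd; have := fd_bound fd; rewrite size_cat /=; lia.
have b1 := bnd _ _ _ _ _ _ fd1 a11 aM1; have b2 := bnd _ _ _ _ _ _ fd2 a21 aM2.
rewrite !phi_step_weave ?fd_fdes // ?fd_maxe // -/e1 -/e2 => E.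
(* Both steps insert the same new maximum, so deleting its copies gives back both old sequences. *)
have Ee : e1 = e2.
  have := filter_weave (gaps (size s1).+1 g1 gs1) (nin _ _ _ _ fd1 a11).
  by rewrite -/e1 E Em filter_weave // nin.
have [Es EM Et] := fd_inj fd1 fd2 Ee.
split=> //; have -> : a1 = a2 by lia.
suff [-> ->] : g1 :: gs1 = g2 :: gs2 by [].
rewrite Ee Em Es in E; rewrite Es in b1.
case/andP: b1 => sb1 lb1; case/andP: b2 => sb2 lb2.
apply: (gaps_inj (ltnW sb1) (ltnW sb2)).
apply: weave_inj E; first exact: nin.
- by apply: leq_trans (sumn_gaps (ltnW sb1)) lb2.
- by apply: leq_trans (sumn_gaps (ltnW sb2)) lb2.
Qed.

(** * Surjectivity of one step *)

(** A weakly increasing prefix cannot extend past the first descent; this bounds the places of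
    insertion. *)
Lemma fd_sorted_take s M t n :
  first_descent s M t -> sorted <=%R (take n (s ++ M :: t)) ->
  (n <= size (s ++ M :: t))%N -> (n <= (size s).+1)%N.
Proof.
move=> fd; rewrite size_cat /= => so ns; rewrite leqNgt; apply/negP => sn.
have ht := fd_head fd.
case: t ht so ns {fd} => [|y t] /= ht; first by lia.
rewrite take_cat ifF; last by lia.
rewrite (_ : n - size s = (n - size s).-2.+2)%N /=; last by lia.
rewrite sorted_cat_cons /= => /and3P[_]; lia.
Qed.

Lemma avoids102_subseq e e' : subseq e e' -> avoids102 e' -> avoids102 e.
Proof.
move=> sub /avoids102P av; apply/avoids102P => x y z s3.
by apply: av; apply: subseq_trans sub.
Qed.

Lemma phi_step_surj s' m t' :
  first_descent s' m t' -> s' != [::] ->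
  exists s M t l, [/\ first_descent s M t, valid_step (s ++ M :: t) l
    & phi_step (s ++ M :: t) l = s' ++ m :: t'].
Proof.
move=> fd'; have [so Is mb ht ta av] := fd'.
case/lastP: s' fd' so Is mb av => [//|s M] fd' so Is mb av _.
have Mm : M <= m by apply: (fd_le fd'); rewrite mem_cat mem_rcons mem_head.
have ss : sorted <=%R (rcons s M).
  by move: so; rewrite !le_sorted_pairwise -[rcons (rcons _ _) _]cats1 pairwise_cat => /and3P[].
have Mb : 0 <= M <= (size s)%:Z.
  have := Is (size s); rewrite size_rcons => /(_ (ltnSn _)).
  by rewrite nth_rcons ltnn eqxx.
have fd0 (x : int) : x \in rcons s M -> x <= M.
  move: ss; rewrite le_sorted_pairwise -cats1 pairwise_cat mem_cat inE.
  case/andP=> /allrelP sM _ /orP[xs|/eqP-> //].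
  by apply: sM => //; rewrite inE.
have [hM|Mh] := ltP (head (-1) t') M.
  have fd : first_descent s M t'.
    split=> //.
    - by move: Is; rewrite -cats1; apply: inversion_seq_catl.
    - have : all (fun x => x <= M) t'.
        case: t' hM ta av {fd' ht} => [//|y t'] /= yM _ av.
        rewrite (ltW yM) /=; apply/allP => z zt; rewrite leNgt; apply/negP => Mz.
        have /avoids102P H := av; apply: (H M y z) => //.
        rewrite cat_rcons; apply: subseq_trans (suffix_subseq _ _).
        apply: (@cat_subseq _ [:: M] [:: y; z] [:: M]) => //.
        apply: subseq_trans (subseq_cons _ m).
        by rewrite /= eqxx sub1seq.
      move/allP => tM; apply/allP => x xt.
      by rewrite tM // andbT; have /allP/(_ x xt)/andP[] := ta.
    - apply: avoids102_subseq av; rewrite -cat_rcons.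
      by apply: cat_subseq => //; apply: subseq_cons.
  have a0 : 0 <= m - M by lia.
  have aM : M + (m - M) <= (size s).+1%:Z by move: mb; rewrite size_rcons; lia.
  exists s, M, t', (m - M, [:: 1]); split=> //.
    by apply/(valid_stepP _ fd); constructor.
  by have [-> _] := phi_step_up_fd fd a0 aM; rewrite addrC subrK.
set s' := rcons s M in so Is mb av fd' *.
have sz : (0 < size s')%N by rewrite size_rcons.
case: t' Mh ht ta av fd' => [|y r] /= My ym ta av fd'; first by lia.
have [ds Ew sds] := weave_filter m (y :: r);
  pose f : seq int := [seq x <- y :: r | x != m].
rewrite -/f in Ew sds.
have Ef : f = y :: [seq x <- r | x != m] by rewrite /f /= (lt_eqF ym).
pose e := s' ++ f.
have mNs : m \notin s'.
  by apply/negP => ms; have := fd0 _ ms; lia.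
have Efil : [seq x <- s' ++ m :: y :: r | x != m] = e.
  rewrite filter_cat /= eqxx -/f (all_filterP _) //.
  by apply/allP => x xs; apply: contraNneq mNs => <-.
have sub_e : subseq e (s' ++ m :: y :: r) by rewrite -Efil filter_subseq.
have in_e x : x \in e -> 0 <= x < m.
  rewrite -Efil mem_filter => /andP[xm xin];
    rewrite lt_neqAle xm (fd_le fd') //= andbT.
  have [_ inv _] := fd_IS102 fd'.
  by move: xin => /(nthP 0)[i ie <-]; have /andP[] := inv i ie.
have ISe : IS102 (size e).-1.+1 e.
  split.
  - by rewrite prednK // size_cat; lia.
  (* Entries that move left on deletion of [m] stay admissible, being less than [m], which is at
     most [size s']. *)
  - apply: inversion_seq_cat => //; apply/allP => x xf.
    have : 0 <= x < m by apply: in_e; rewrite mem_cat xf orbT.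
    by lia.
  - exact: avoids102_subseq av.
have [s0 [M0 [t0 [Ee fd0']]]] := IS102_fd ISe.
pose p := (size s0).+1; pose d := size s'.
have Edw : weave m (d :: ds) e = s' ++ m :: y :: r.
  by rewrite /= /d /e take_size_cat // drop_size_cat // -Ew.
have de : (d < size e)%N by rewrite size_cat Ef /= /d; lia.
(* Since [M <= y], the prefix [rcons s' y] of [e] still increases weakly. *)
have dp : (d < p)%N.
  apply: (fd_sorted_take fd0'); rewrite -Ee // take_cat ifF; last by lia.
  rewrite Ef subSnn /= take0 cats1; exact: sorted_rcons2.
(* A descending pair before the last copy of [m] would form a 102 with that copy. *)
have dsp : (d + sumn ds <= p)%N.
  have le_e : (d + sumn ds <= size e)%N by rewrite size_cat leq_add2l.
  apply: (fd_sorted_take fd0'); rewrite -Ee //.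
  apply/subseq2_sorted => x y' sub; rewrite leNgt; apply/negP => yx.
  have /avoids102P H := av; apply: (H x y' m).
    have := @subseq_weave _ m (d :: ds) e isT.
    rewrite Edw; apply: subseq_trans.
    by rewrite -[[:: x; y'; m]]/(rcons [:: x; y'] m) -!cats1 cat_subseq.
  split=> //; suff /in_e/andP[] : x \in e by [].
  by apply: (@mem_take (d + sumn ds)); apply: (mem_subseq sub); rewrite mem_head.
(* A first gap 0 would put a copy of [m] in the place of [y]; for empty [ds], use [d < p]. *)
have hds : head (p - d)%N ds != 0%N.
  case: (ds) Ew => [|[|h] ds'] //=; first by lia.
  by rewrite take0 => -[Eym _]; lia.
have [g [gs [Esum Eg]]] := gaps_surj dsp hds.
have M0m : M0 < m by have /in_e/andP[] : M0 \in e by rewrite Ee mem_cat mem_head orbT.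
(* The g_i sum to [p - d - 1], which is [size s0 - size s'], so the claim is [m <= size s']. *)
have aM : M0 + (m - M0) + (sumn (g :: gs))%:Z <= (size s0)%:Z.
  by move: Esum dp mb; rewrite /p /d /=; lia.
exists s0, M0, t0, (m - M0, oppz_seq (g :: gs)); split=> //.
  by apply/(valid_stepP _ fd0'); constructor=> //; lia.
have pe : (p <= size e)%N by rewrite Ee size_cat /= /p; lia.
rewrite phi_step_weave fd_fdes // ?fd_maxe // -/p -Ee; last by rewrite Esum pe /d;
  lia.
by rewrite Eg addrC subrK.
Qed.

(** * From single steps to whole paths *)

Lemma height_rcons Q l :
  height (rcons Q l) = height Q + (step_of l).2 - (step_of l).1.
Proof.
have last_vertices s v : last 0 (vertices (rcons s v)) = last 0 (vertices s) + v.
  rewrite /vertices scanl_rcons /= last_rcons foldl_rcons; congr (_ + v).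
  by elim: s (0 : int * int) => [//|w s IH] P /=; rewrite IH.
by rewrite /height map_rcons last_vertices /=; lia.
Qed.

Lemma labeled_F_path_rcons Q l :
  labeled_F_path (rcons Q l) =
  [&& labeled_F_path Q, in_F (step_of l), label_ok l & 0 <= height (rcons Q l)].
Proof.
rewrite /labeled_F_path /F_path /height /vertices map_rcons scanl_rcons -rcons_cons.
rewrite !all_rcons last_rcons subr_ge0.
set P := foldl _ _ _; case: (in_F _); case: (label_ok l); case: (P.1 <= P.2);
  by rewrite ?andbF ?andbT.
Qed.

Lemma phi_rcons Q l : phi (rcons Q l) = phi_step (phi Q) l.
Proof. exact: foldl_rcons. Qed.

Lemma semilength_rcons Q l : semilength (rcons Q l) = (semilength Q + size l.2)%N.
Proof. by rewrite /semilength -cats1 big_cat big_seq1. Qed.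

Lemma size_label_gt0 l : label_ok l -> (0 < size l.2)%N.
Proof. by case/orP => [/eqP->|/andP[]]. Qed.

Lemma valid_step_phi Q l :
  labeled_F_path Q -> height Q = rank (phi Q) ->
  labeled_F_path (rcons Q l) = valid_step (phi Q) l.
Proof. by move=> LQ hQ; rewrite labeled_F_path_rcons LQ height_rcons hQ. Qed.

Lemma fd_nil_zero : first_descent [::] 0 [::].
Proof. by split=> // i j k _ jk /= k1; lia. Qed.

(** The claims are proved together: the equality of height and rank makes the next label a valid
    step, and the decomposition lets the step lemmas apply. *)
Lemma phi_fd Q : labeled_F_path Q ->
  [/\ exists s M t, phi Q = s ++ M :: t /\ first_descent s M t,
      height Q = rank (phi Q) & size (phi Q) = (semilength Q).+1].
Proof.
elim/last_ind: Q => [_|Q l IH LQl].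
  split; last by rewrite /semilength big_nil.
    by exists [::], 0, [::]; split=> //; apply: fd_nil_zero.
  by rewrite (fd_rank fd_nil_zero).
have LQ : labeled_F_path Q by move: LQl; rewrite labeled_F_path_rcons => /and4P[].
have [[s [M [t [Ephi fd]]]] hQ sQ] := IH LQ.
move: LQl; rewrite (valid_step_phi _ LQ hQ) phi_rcons height_rcons hQ semilength_rcons Ephi.
move=> v; have [s' [t' [E fd' ss' _]]] := phi_step_fd fd v.
split.
- by exists s', (M + l.1), t'.
- by rewrite E !fd_rank // ss' /step_of /=; lia.
- by rewrite (size_phi_step fd v) -Ephi sQ.
Qed.

Lemma phi_IS102 n Q : LF n Q -> IS102 n.+1 (phi Q).
Proof.
case=> LQ <-; have [[s [M [t [E fd]]]] _ <-] := phi_fd LQ.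
by rewrite E; apply: fd_IS102.
Qed.

Lemma phi_inj Q1 Q2 :
  labeled_F_path Q1 -> labeled_F_path Q2 -> phi Q1 = phi Q2 -> Q1 = Q2.
Proof.
(* A nonempty path has positive semilength, so its image is longer than (0). *)
have neq_nil Q l : labeled_F_path (rcons Q l) -> phi (rcons Q l) <> phi [::].
  move=> LQ /(congr1 size); have [_ _ ->] := phi_fd LQ.
  move: LQ; rewrite labeled_F_path_rcons semilength_rcons => /and4P[_ _ /size_label_gt0].
  by rewrite /=; lia.
elim/last_ind: Q1 Q2 => [|Q1 l1 IH] Q2; case/lastP: Q2 => [|Q2 l2] //.
- by move=> _ /neq_nil H E; case: H.
- by move=> /neq_nil.
move=> L1 L2.
have [LQ1 LQ2] : labeled_F_path Q1 /\ labeled_F_path Q2.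
  by move: L1 L2; rewrite !labeled_F_path_rcons => /and4P[-> _ _ _] /and4P[].
have [[s1 [M1 [t1 [E1 fd1]]]] h1 _] := phi_fd LQ1.
have [[s2 [M2 [t2 [E2 fd2]]]] h2 _] := phi_fd LQ2.
move: L1 L2; rewrite !valid_step_phi // !phi_rcons E1 E2 => v1 v2.
case/(phi_step_inj fd1 fd2 v1 v2) => E ->.
by rewrite (IH Q2) // E1 E2.
Qed.

(** Induction on the length: undoing a step removes at least one entry, as labels have positive
    semilength. *)
Lemma phi_surj n e :
  IS102 n.+1 e -> exists2 Q, labeled_F_path Q & phi Q = e.
Proof.
elim/ltn_ind: n e => n IH e ISe; have [se _ _] := ISe.
have [s' [m [t' [Ee fd']]]] := IS102_fd ISe.
have [s'0|s'N] := eqVneq s' [::].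
  (* With no entry before it the maximum is 0, and the nonnegative tail must be empty since its head
     would be negative. *)
  exists [::] => //; rewrite Ee s'0 /=;
    move: (fd_bound fd') (fd_head fd') (fd_tail fd').
  rewrite s'0 => /= mb; have -> : m = 0 by lia.
  by case: (t') => [//|y t] /= y0; lia.
have [s [M [t [l [fd v E]]]]] := phi_step_surj fd' s'N.
have lk : label_ok l by case/and3P: v.
have := fd_IS102 fd; set f := s ++ M :: t in v E * => ISf.
have f0 : size f = (size f).-1.+1 by rewrite /f size_cat /= addnS.
have sf : (size f + size l.2)%N = n.+1.
  by rewrite -se Ee -E -(size_phi_step fd v).
rewrite f0 in ISf; have [|Q LQ EQ] := IH _ _ _ ISf.
  by have := size_label_gt0 lk; lia.
have [_ hQ _] := phi_fd LQ.
by exists (rcons Q l); rewrite ?(valid_step_phi _ LQ hQ) ?phi_rcons EQ // E Ee.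
Qed.

Theorem theorem3p1 :
  [/\ forall (n : nat) (Q : seq label), LF n Q -> IS102 n.+1 (phi Q),
      set_bij (\bigcup_n LF n) (\bigcup_n IS102 n.+1) phi
    & forall Q : seq label, (\bigcup_n LF n) Q -> height Q = rank (phi Q)].
Proof.
split; [exact: phi_IS102 | split | by move=> Q [n _ [/phi_fd[]]]].
- by move=> Q [n _ LQ]; exists n => //; apply: phi_IS102.
- by move=> Q1 Q2 /set_mem[n1 _ [L1 _]] /set_mem[n2 _ [L2 _]]; apply: phi_inj.
- by move=> e [n _ /phi_surj[Q LQ <-]]; exists Q => //; exists (semilength Q).
Qed.
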